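(* Consider the $n$-dimensional axisymmetric Veselova top, with $n>3$ and mass tensor $\mathbb{J}=\mathrm{diag}[J_1,J_2,\dots,J_2]$. Consider any solution to the reduced equations on $\mathcal{R}=T^*\mathrm{S}^{n-1}/\mathrm{O}(n-1)$, and a choice of initial lift to both $T^*\mathrm{S}^{n-1}$ and $D$. Then there exist choices of (orthonormal) basis of $\mathbb{R}^n$ in the body and in space, the first containing $f_1$ and the second $e_1$, such that with respect to these bases the lifted solutions $(q(t),p(t))$ and $(g(t),\Omega(t))$ have the form $$q(t)=\begin{pmatrix}\bar q(t)\\0\end{pmatrix},\quad p(t)=\begin{pmatrix}\bar p(t)\\0\end{pmatrix},\quad g(t)=\begin{pmatrix}\bar g(t)&0\\0&\mathrm{Id}_{n-3}\end{pmatrix},\quad \Omega(t)=\begin{pmatrix}\bar\Omega(t)&0\\0&0_{n-3}\end{pmatrix},$$ where $(\bar q(t),\bar p(t))\in T^*\mathrm{S}^2$ and $(\bar g(t),\bar\Omega(t))\in D(3)\subset T\mathrm{O}(3)$ satisfy the equations of motion of the axisymmetric 3D Veselova top (for $\bar g,\bar\Omega$) and its reduced equations (for $(\bar q,\bar p)$), with mass tensor $\bar{\mathbb{J}}=\mathrm{diag}[J_1,J_2,J_2]$.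
   Context: The $m$-dimensional Veselova top with mass tensor $\mathbb{J}=\mathrm{diag}[j_1,\dots,j_m]$, $j_i>0$: put $a\wedge b=ab^T-ba^T$, $\langle\Lambda,\Omega\rangle=\tfrac12\mathrm{tr}(\Lambda^T\Omega)$ and $\mathbb{I}(\Omega)=\mathbb{J}\Omega+\Omega\mathbb{J}$ on $\mathfrak{so}(m)$; let $e_1,\dots,e_m$ be an orthonormal basis of space and $f_1,\dots,f_m$ a principal basis of the body (each identified with the standard basis of $\mathbb{R}^m$). For $g\in\mathrm{O}(m)$ put $q=g^{-1}e_1$, $E_r=g^{-1}e_r$. Phase space (using the left trivialisation $T\mathrm{O}(m)\cong\mathrm{O}(m)\times\mathfrak{so}(m)$, $\Omega=g^{-1}\dot g$): $D=D(m)=\{(g,\Omega):\Omega=q\wedge v\text{ for some }v\in\mathbb{R}^m\}$. Equations of motion on $D(m)$: $\dot g=g\Omega$, $\frac{d}{dt}\mathbb{I}(\Omega)=[\mathbb{I}(\Omega),\Omega]+\sum_{2\le r<s\le m}\lambda_{rs}E_r\wedge E_s$, with $\lambda_{rs}$ uniquely determined by preservation of the constraints $\langle E_r\wedge E_s,\Omega\rangle=0$. Reduced equations on $T^*\mathrm{S}^{m-1}=\{(q,p)\in\mathbb{R}^m\times\mathbb{R}^m:\|q\|=1,\ q\cdot p=0\}$, reached via $(g,\Omega)\mapsto(q,p)$, $q=g^{-1}e_1$, $p=-\mathbb{I}(\Omega)q$: $$\dot q=C\left[p-\frac{p\cdot Cq}{q\cdot Cq}q\right],\quad \dot p=-2Hq,\quad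 C=(\mathbb{J}+(q\cdot\mathbb{J}q)\mathrm{Id}_m)^{-1},\quad H=\tfrac12\left(p\cdot Cp-\tfrac{(p\cdot Cq)^2}{q\cdot Cq}\right).$$ Axisymmetric top: $m=n$, $\mathbb{J}=\mathrm{diag}[J_1,J_2,\dots,J_2]$ with $J_1\neq J_2$; $\mathrm{O}(n-1)$ (orthogonal transformations of the body fixing $f_1$) acts diagonally on $T^*\mathrm{S}^{n-1}$, preserving the equations, and the reduced dynamics descends to $\mathcal{R}$. An initial lift is a choice of $(g_0,\Omega_0)\in D$ with image $(q_0,p_0)\in T^*\mathrm{S}^{n-1}$ projecting to the initial point in $\mathcal{R}$. Changing the orthonormal bases in body and space by orthogonal matrices $P_b$ and $P_s$ replaces $q,p,g,\Omega$ by $P_bq,\ P_bp,\ P_s\,g\,P_b^T,\ P_b\Omega P_b^T$. *)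

(* Defs.v *)
From HB Require Import structures.
From mathcomp Require Import all_boot all_order all_algebra.
From mathcomp Require Import all_classical all_reals all_analysis.

Set Implicit Arguments.
Unset Strict Implicit.
Unset Printing Implicit Defensive.

Import Order.TTheory GRing.Theory Num.Theory.
Import numFieldNormedType.Exports.

Local Open Scope classical_set_scope.
Local Open Scope ring_scope.

Section Veselova.
Context {R : realType}.

Section AnyDimension.
Context {m : nat}.
Implicit Types (a b q p v : 'cV[R]_m) (J g L Om P : 'M[R]_m) (I : set R).

(* Indices are 0-based: [stdvec 0] is the first standard basis vector, i.e. e_1
   when read in space and f_1 when read in the body. *)
Definition stdvec (i : nat) : 'cV[R]_m := \col_(j < m) ((j : nat) == i)%:R.

(* The Euclidean product; the library's [`|_|] on matrices is the sup norm. *)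
Definition dot a b : R := (a^T *m b) 0 0.

Definition is_orthogonal_mx P : Prop := P^T *m P = 1%:M.

Definition vwedge a b : 'M[R]_m := a *m b^T - b *m a^T.

Definition inertia_op J Om : 'M[R]_m := J *m Om + Om *m J.

Definition body_frame g (r : nat) : 'cV[R]_m := invmx g *m stdvec r.

Definition phase_D : set ('M[R]_m * 'M[R]_m) :=
  [set x | is_orthogonal_mx x.1 /\ exists v, x.2 = vwedge (body_frame x.1 0) v].

(* Preservation of the constraints, which determines the multipliers, is the
   requirement that the trajectory stays in [phase_D]. The sum over
   0 < r < s < m is the sum over 2 <= r < s <= m of the 1-based indexing. *)
Definition veselova_solution J I (g Om : R -> 'M[R]_m) : Prop :=
  exists lam : R -> 'I_m -> 'I_m -> R, forall t, I t ->
    [/\ phase_D (g t, Om t),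
        is_derive t 1 g (g t *m Om t)
      & is_derive t 1 (fun s => inertia_op J (Om s))
          (inertia_op J (Om t) *m Om t - Om t *m inertia_op J (Om t)
           + \sum_(r < m) \sum_(s < m | (0 < r < s)%N)
               lam t r s *: vwedge (body_frame (g t) r) (body_frame (g t) s))].

Definition cotangent_sphere : set ('cV[R]_m * 'cV[R]_m) :=
  [set x | dot x.1 x.1 = 1 /\ dot x.1 x.2 = 0].

Definition Cmx J q : 'M[R]_m := invmx (J + (dot q (J *m q))%:M).

Definition hamiltonian J q p : R :=
  2^-1 * (dot p (Cmx J q *m p)
          - dot p (Cmx J q *m q) ^+ 2 / dot q (Cmx J q *m q)).

Definition reduced_solution J I (q p : R -> 'cV[R]_m) : Prop :=
  forall t, I t ->
    [/\ cotangent_sphere (q t, p t),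
        is_derive t 1 q
          (let C := Cmx J (q t) in
           C *m (p t - (dot (p t) (C *m q t) / dot (q t) (C *m q t)) *: q t))
      & is_derive t 1 p (- 2 * hamiltonian J (q t) (p t) *: q t)].

Definition reduction J (x : 'M[R]_m * 'M[R]_m) : 'cV[R]_m * 'cV[R]_m :=
  let q := body_frame x.1 0 in (q, - (inertia_op J x.2 *m q)).

(* The orbit of a point under the diagonal action of O(m-1), the stabiliser of
   f_1 in O(m); a point of the quotient T^*S^{m-1}/O(m-1) is such an orbit. *)
Definition axial_orbit (x : 'cV[R]_m * 'cV[R]_m) : set ('cV[R]_m * 'cV[R]_m) :=
  [set y | exists P, [/\ is_orthogonal_mx P, P *m stdvec 0 = stdvec 0
                       & y = (P *m x.1, P *m x.2)]].

(* The dynamics on the quotient is the one descending from T^*S^{m-1}. *)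
Definition quotient_solution J I
    (gam : R -> set ('cV[R]_m * 'cV[R]_m)) : Prop :=
  exists q p : R -> 'cV[R]_m,
    reduced_solution J I q p /\ forall t, I t -> gam t = axial_orbit (q t, p t).

End AnyDimension.

Definition axisym_tensor (m : nat) (J1 J2 : R) : 'M[R]_m :=
  diag_mx (\row_(i < m) if (i : nat) == 0%N then J1 else J2).

End Veselova.

(* Main.v *)
Require Import Defs.
From mathcomp Require Import all_boot all_order all_algebra.
From mathcomp Require Import all_classical all_reals all_analysis.
From mathcomp Require Import ring lra.
Import Order.TTheory GRing.Theory Num.Theory.
Import numFieldNormedType.Exports.
Local Open Scope classical_set_scope.
Local Open Scope ring_scope.

Set Implicit Arguments.
Unset Strict Implicit.
Unset Printing Implicit Defensive.

(** The momentum of the Veselova top satisfies p' = - 2 H q, and for an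
    axisymmetric mass tensor C acts as a scalar on vectors orthogonal to the
    symmetry axis f_1.  Hence, for w orthogonal to f_1, the pair (w.q, w.p)
    solves a homogeneous linear system of two scalar equations, whose
    coefficients are continuous functions of time along the given solution.
    If w is also orthogonal to q_0 and p_0, then (w.q, w.p) starts at zero and
    so vanishes identically ([reduced_invariant_hyperplane]).  So q and p never
    leave a three-dimensional space V containing f_1, q_0 and p_0; the body
    basis is chosen with its first three vectors spanning V.

    The same applies to the full motion, because the image of (g, Omega) under
    the reduction is itself a solution of the reduced equations
    ([reduction_solution]), with Omega = q /\ q'.  Thus Omega lives on V and
    kills its orthogonal complement, so g' = g Omega makes the images under g
    of the last n - 3 body vectors constant in space.  They are orthogonal to
    e_1 because q stays in V.  Taking them as the last space vectors puts g in
    block form.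

    The three-dimensional equations are those of the large top, pulled back
    along the isometric inclusions of R^3 into the body and the space.  The
    inclusion S into the body maps the axis to the axis, so it intertwines the
    two axisymmetric mass tensors ([axisym_tensor_embedding]), whence the
    reduced equations ([reduced_solution_embedding]).  For the full ones the
    constraint forces must again be combinations of the E_r /\ E_s
    ([veselova_solution_embedding]): the projected force is a skew matrix
    killing q, and every such matrix is one
    ([skew_kills_axis_decomposition]). *)

(** * Derivatives of matrix-valued functions *)

Lemma is_derive_mxP (R : realType) (m n : nat) (f : R -> 'M[R]_(m, n))
    (df : 'M[R]_(m, n)) (t : R) :
  is_derive t 1 f df <-> forall i j, is_derive t 1 (fun s => f s i j) (df i j).
Proof.
split=> [dft i j|dft].
  have [fd fE] := dft.
  apply: DeriveDef; first exact: (derivable_mxP f t 1).1.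
  by rewrite -fE derive_mx // mxE.
have fd : derivable f t 1.
  by apply/derivable_mxP => i j; have [] := dft i j.
apply: DeriveDef => //; rewrite derive_mx //; apply/matrixP => i j.
by rewrite mxE; have [] := dft i j.
Qed.

Lemma is_derive_mulmx (R : realType) (m n p : nat) (f : R -> 'M[R]_(m, n))
    (g : R -> 'M[R]_(n, p)) (df : 'M[R]_(m, n)) (dg : 'M[R]_(n, p)) (t : R) :
  is_derive t 1 f df -> is_derive t 1 g dg ->
  is_derive t 1 (fun s => f s *m g s) (df *m g t + f t *m dg).
Proof.
move=> /is_derive_mxP df1 /is_derive_mxP dg1; apply/is_derive_mxP => i j.
have -> : (fun s => (f s *m g s) i j)
    = \sum_k ((fun s => f s i k) * (fun s => g s k j)).
  by apply/funext => s; rewrite mxE fct_sumE.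
have dfg k : is_derive t 1 ((fun s => f s i k) * (fun s => g s k j) : R -> R)
    (f t i k *: dg k j + g t k j *: df i k).
  exact: is_deriveM.
have -> : (df *m g t + f t *m dg) i j
    = \sum_k (f t i k *: dg k j + g t k j *: df i k).
  rewrite !mxE -big_split /=; apply: eq_bigr => k _.
  by rewrite /GRing.scale /= addrC [g t k j * _]mulrC.
exact: is_derive_sum dfg.
Qed.

Lemma is_derive_mulmxl (R : realType) (m n p : nat) (A : 'M[R]_(m, n))
    (g : R -> 'M[R]_(n, p)) (dg : 'M[R]_(n, p)) (t : R) :
  is_derive t 1 g dg -> is_derive t 1 (fun s => A *m g s) (A *m dg).
Proof.
move=> dg1; have := is_derive_mulmx (is_derive_cst A t 1) dg1.
by rewrite mul0mx add0r.
Qed.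

Lemma is_derive_mulmxr (R : realType) (m n p : nat) (f : R -> 'M[R]_(m, n))
    (B : 'M[R]_(n, p)) (df : 'M[R]_(m, n)) (t : R) :
  is_derive t 1 f df -> is_derive t 1 (fun s => f s *m B) (df *m B).
Proof.
move=> df1; have := is_derive_mulmx df1 (is_derive_cst B t 1).
by rewrite mulmx0 addr0.
Qed.

Lemma is_derive_trmx (R : realType) (m n : nat) (f : R -> 'M[R]_(m, n))
    (df : 'M[R]_(m, n)) (t : R) :
  is_derive t 1 f df -> is_derive t 1 (fun s => (f s)^T) df^T.
Proof.
move=> /is_derive_mxP df1; apply/is_derive_mxP => i j.
have := df1 j i; rewrite mxE; congr is_derive.
by apply/funext => s; rewrite mxE.
Qed.

Lemma is_derive_dot (R : realType) (m : nat) (w : 'cV[R]_m)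
    (f : R -> 'cV[R]_m) (df : 'cV[R]_m) (t : R) :
  is_derive t 1 f df -> is_derive t 1 (fun s => dot w (f s)) (dot w df).
Proof. by move=> /(is_derive_mulmxl w^T)/is_derive_mxP/(_ 0 0). Qed.

Lemma is_derive_continuous (R : realType) (f : R -> R) (df t : R) :
  is_derive t 1 f df -> {for t, continuous f}.
Proof. by move=> [/derivable1_diffP/differentiable_continuous]. Qed.

(** * Vanishing of solutions of linear differential equations *)

(** If E' <= K E on [t0, t], then exp(- K s) E(s) is nonincreasing there; K is
    the maximum of k on that segment. *)
Lemma gronwall_right (R : realType) (I : set R) (I_itv : is_interval I)
    (k E dE : R -> R)
    (k_cont : forall t, I t -> {for t, continuous k})
    (E_ge0 : forall t, I t -> 0 <= E t)
    (E_der : forall t, I t -> is_derive t 1 E (dE t))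
    (E_le : forall t, I t -> dE t <= k t * E t)
    (t0 t : R) (It0 : I t0) (It : I t) (E0 : E t0 = 0) (le_t0t : t0 <= t) :
  E t = 0.
Proof.
have sub s : s \in `[t0, t]%R -> I s.
  rewrite in_itv /= => /andP[h1 h2]; apply: (I_itv t0 t) => //.
  by rewrite h1 h2.
have kW : {within `[t0, t], continuous k}.
  apply: continuous_in_subspaceT => s; rewrite inE => /= h.
  exact/k_cont/sub.
have [c _ kc] := EVT_max le_t0t kW.
set K := k c; pose e (s : R) := expR (- K * s); pose F : R -> R := e * E.
have dF s : I s -> is_derive s 1 F (e s * (dE s - K * E s)).
  move=> Is; have dEs := E_der s Is.
  have de : is_derive s 1 e (- K * e s).
    rewrite /e -[fun s => expR _]/(expR \o (fun s => - K * s)).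
    have lin : is_derive s 1 (fun s : R => - K * s) (- K).
      have := is_deriveM (is_derive_cst (- K) s 1) (is_derive_id s (1 : R)).
      by rewrite scaler0 addr0 [_ *: _]mulr1.
    have := is_derive1_comp (is_derive_expR (- K * s)) lin.
    by rewrite mulrC.
  apply: is_derive_eq; rewrite /GRing.scale /=; ring.
have dFle s : s \in `]t0, t[%R -> derive1 F s <= 0.
  move=> hs; have hs' : s \in `[t0, t]%R by apply: subset_itv_oo_cc hs.
  rewrite derive1E; have [_ ->] := dF s (sub s hs').
  rewrite pmulr_rle0 ?expR_gt0 // subr_le0.
  apply: le_trans (E_le s (sub s hs')) _.
  by apply: ler_wpM2r; [exact/E_ge0/sub|exact: kc].
have Fc : {within `[t0, t], continuous F}.
  apply: continuous_in_subspaceT => s; rewrite inE => /= h.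
  exact/(is_derive_continuous (dF s (sub s h))).
have Fd s : s \in `]t0, t[%R -> derivable F s 1.
  move=> hs; have hs' : s \in `[t0, t]%R by apply: subset_itv_oo_cc hs.
  by have [] := dF s (sub s hs').
have ht : t \in `[t0, t]%R by rewrite in_itv /= le_t0t lexx.
have ht0 : t0 \in `[t0, t]%R by rewrite in_itv /= le_t0t lexx.
have := ler0_derive1_le_cc Fd dFle Fc ht ht0 le_t0t.
rewrite /F /GRing.mul /= E0 [X in _ <= X]mulr0 => h.
apply/eqP; rewrite eq_le E_ge0 // andbT.
by rewrite -(pmulr_rle0 _ (expR_gt0 (- K * t))).
Qed.

(** Going backwards in time is going forwards for s |-> E(- s), which is why the
    bound is on the absolute value of the derivative. *)
Lemma gronwall (R : realType) (I : set R) (I_itv : is_interval I)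
    (k E dE : R -> R)
    (k_cont : forall t, I t -> {for t, continuous k})
    (E_ge0 : forall t, I t -> 0 <= E t)
    (E_der : forall t, I t -> is_derive t 1 E (dE t))
    (E_le : forall t, I t -> `|dE t| <= k t * E t)
    (t0 : R) (It0 : I t0) (E0 : E t0 = 0) (t : R) (It : I t) :
  E t = 0.
Proof.
have [le_t0t|/ltW le_tt0] := leP t0 t.
  apply: (@gronwall_right R I I_itv k E dE) It0 It E0 le_t0t => // s Is.
  exact: le_trans (ler_norm _) (E_le s Is).
rewrite -[t]opprK -[E _]/((E \o -%R) (- t)).
apply: (@gronwall_right R (I \o -%R) _ (k \o -%R) (E \o -%R)
  (fun s => - dE (- s)) _ _ _ _ (- t0)) => //=; rewrite ?opprK ?lerN2 //.
- move=> x y Ix Iy z /andP[xz zy] /=; apply: (I_itv (- y) (- x)) => //.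
  by rewrite !lerN2 xz zy.
- move=> s Is; apply: continuous_comp; first exact: oppr_continuous.
  exact: k_cont.
- by move=> s; exact: E_ge0.
- move=> s Is; have := is_derive1_comp (E_der (- s) Is) (is_deriveNid s (1:R)).
  by rewrite mulrN1.
- move=> s Is; apply: le_trans (E_le _ Is).
  by rewrite -normrN ler_norm.
Qed.

(** Gronwall applies to the energy x^2 + y^2, as |2 x y| <= x^2 + y^2. *)
Lemma linear_system_zero (R : realType) (I : set R) (I_itv : is_interval I)
    (a b c d x y : R -> R)
    (abcd_cont : forall t, I t -> [/\ {for t, continuous a},
      {for t, continuous b}, {for t, continuous c} & {for t, continuous d}])
    (x_der : forall t, I t -> is_derive t 1 x (a t * x t + b t * y t))
    (y_der : forall t, I t -> is_derive t 1 y (c t * x t + d t * y t))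
    (t0 : R) (It0 : I t0) (x0 : x t0 = 0) (y0 : y t0 = 0) (t : R) (It : I t) :
  x t = 0 /\ y t = 0.
Proof.
pose k s := 2 * (`|a s| + `|b s| + `|c s| + `|d s|).
pose E : R -> R := x * x + y * y.
have EE s : E s = x s ^+ 2 + y s ^+ 2 by rewrite !expr2.
pose dE s := 2 * x s * (a s * x s + b s * y s)
  + 2 * y s * (c s * x s + d s * y s).
have k_cont s : I s -> {for s, continuous k}.
  move=> Is; have [ca cb cc cd] := abcd_cont s Is.
  have cn (f : R -> R) : {for s, continuous f} ->
      {for s, continuous (fun u => `|f u|)}.
    by move=> cf; apply: (continuous_comp cf); exact: norm_continuous.
  apply: (@continuousM _ _ (fun=> 2) _ s); first exact: cst_continuous.
  by do 3?[apply: continuousD]; exact: cn.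
have E_ge0 s : I s -> 0 <= E s by rewrite EE addr_ge0 // sqr_ge0.
have E_der s : I s -> is_derive s 1 E (dE s).
  move=> Is; have dx := x_der s Is; have dy := y_der s Is.
  have := is_deriveD (is_deriveM dx dx) (is_deriveM dy dy).
  by congr is_derive; rewrite /dE /GRing.scale /=; ring.
have E_le s : I s -> `|dE s| <= k s * E s.
  move=> Is; rewrite EE /k /dE.
  have hxy : `|x s * y s| <= (x s ^+ 2 + y s ^+ 2) / 2.
    have h1 := sqr_ge0 (x s - y s); have h2 := sqr_ge0 (x s + y s).
    by rewrite ler_norml; apply/andP; split; nra.
  have hx := sqr_ge0 (x s); have hy := sqr_ge0 (y s).
  have bnd (u v : R) (h : `|v| <= x s ^+ 2 + y s ^+ 2) :
      `|u * v| <= `|u| * (x s ^+ 2 + y s ^+ 2).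
    by rewrite normrM ler_wpM2l.
  have -> : 2 * x s * (a s * x s + b s * y s)
      + 2 * y s * (c s * x s + d s * y s)
    = 2 * (a s * x s ^+ 2 + b s * (x s * y s)
      + c s * (x s * y s) + d s * y s ^+ 2) by ring.
  rewrite normrM ger0_norm // -mulrA ler_wpM2l // !mulrDl.
  do 3?[apply: le_trans (ler_normD _ _) _; apply: lerD]; apply: bnd.
  - by rewrite ger0_norm //; lra.
  - by lra.
  - by lra.
  - by rewrite ger0_norm //; lra.
have E0 : E t0 = 0 by rewrite EE x0 y0 expr0n addr0.
have := gronwall I_itv k_cont E_ge0 E_der E_le It0 E0 It.
move=> /eqP; rewrite EE paddr_eq0 ?sqr_ge0 // !sqrf_eq0.
by move=> /andP[/eqP -> /eqP ->].
Qed.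

Lemma derive_eq0_constant (R : realType) (I : set R) (I_itv : is_interval I)
    (m n : nat) (f : R -> 'M[R]_(m, n))
    (f_der : forall t, I t -> is_derive t 1 f 0)
    (t0 t : R) (It0 : I t0) (It : I t) : f t = f t0.
Proof.
apply/matrixP => i j; apply/eqP; rewrite -subr_eq0; apply/eqP.
pose z s := f s i j - f t0 i j; pose o (s : R) : R := 0.
have o_cont s : I s -> [/\ {for s, continuous o}, {for s, continuous o},
    {for s, continuous o} & {for s, continuous o}].
  by move=> _; split; exact: cst_continuous.
have z_der s : I s -> is_derive s 1 z (o s * z s + o s * o s).
  move=> Is; rewrite /o !mul0r addr0.
  have /is_derive_mxP/(_ i j) := f_der s Is; rewrite mxE => d.
  by have := is_deriveB d (is_derive_cst (f t0 i j) s 1); rewrite subr0.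
have o_der s : I s -> is_derive s 1 o (o s * z s + o s * o s).
  by move=> Is; rewrite /o !mul0r addr0; exact: is_derive_cst.
have z0 : z t0 = 0 by rewrite /z subrr.
by have [] := linear_system_zero I_itv o_cont z_der o_der It0 z0 (erefl 0) It.
Qed.

(** * Euclidean geometry of column vectors *)

Section EuclideanAlgebra.
Context {R : realType}.

Lemma dotE m (a b : 'cV[R]_m) : dot a b = \sum_i a i 0 * b i 0.
Proof. by rewrite /dot mxE; apply: eq_bigr => i _; rewrite mxE. Qed.

Lemma dotC m (a b : 'cV[R]_m) : dot a b = dot b a.
Proof. by rewrite !dotE; apply: eq_bigr => i _; rewrite mulrC. Qed.

Lemma dotDr m (a b c : 'cV[R]_m) : dot a (b + c) = dot a b + dot a c.
Proof. by rewrite /dot mulmxDr mxE. Qed.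

Lemma dotNr m (a b : 'cV[R]_m) : dot a (- b) = - dot a b.
Proof. by rewrite /dot mulmxN mxE. Qed.

Lemma dotBr m (a b c : 'cV[R]_m) : dot a (b - c) = dot a b - dot a c.
Proof. by rewrite dotDr dotNr. Qed.

Lemma dotZr m x (a b : 'cV[R]_m) : dot a (x *: b) = x * dot a b.
Proof. by rewrite /dot -scalemxAr mxE. Qed.

Lemma dotBl m (a b c : 'cV[R]_m) : dot (a - b) c = dot a c - dot b c.
Proof. by rewrite dotC dotBr !(dotC c). Qed.

Lemma dot_mull m n (A : 'M[R]_(m, n)) a b : dot (A *m a) b = dot a (A^T *m b).
Proof. by rewrite /dot trmx_mul mulmxA. Qed.

Lemma trmx_mulE m (a b : 'cV[R]_m) : a^T *m b = (dot a b)%:M.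
Proof. by rewrite [LHS]mx11_scalar. Qed.

Lemma outer_mul m n (a : 'cV[R]_m) (b c : 'cV[R]_n) :
  a *m b^T *m c = dot b c *: a.
Proof. by rewrite -mulmxA trmx_mulE mul_mx_scalar. Qed.

Lemma dot_eq0 m (a : 'cV[R]_m) : dot a a = 0 -> a = 0.
Proof.
rewrite dotE => /eqP; rewrite psumr_eq0 => [/allP a0|i _]; last first.
  by rewrite -expr2 sqr_ge0.
apply/colP => i; rewrite mxE; apply/eqP.
by have /= := a0 i (mem_index_enum i); rewrite mulf_eq0 orbb.
Qed.

Lemma dot_stdvec m (i : 'I_m) (a : 'cV[R]_m) : dot (stdvec i) a = a i 0.
Proof.
rewrite dotE (bigD1 i) //= big1 => [|j ji]; rewrite mxE ?eqxx ?mul1r ?addr0 //.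
by rewrite (inj_eq val_inj) (negPf ji) mul0r.
Qed.

Lemma dot_stdvec_stdvec m (i j : 'I_m) :
  dot (stdvec i) (stdvec j : 'cV[R]_m) = (i == j)%:R.
Proof. by rewrite dot_stdvec mxE (inj_eq val_inj). Qed.

Lemma mulmx_stdvec m (i : 'I_m) n (A : 'M[R]_(n, m)) :
  A *m stdvec i = col i A.
Proof.
apply/colP => j; rewrite !mxE (bigD1 i) //= big1 => [|l li].
  by rewrite mxE eqxx mulr1 addr0.
by rewrite mxE (inj_eq val_inj) (negPf li) mulr0.
Qed.

Lemma orthogonal_mxC m (P : 'M[R]_m) :
  is_orthogonal_mx P -> P *m P^T = 1%:M.
Proof. exact: mulmx1C. Qed.

Lemma orthogonal_mx_inv m (P : 'M[R]_m) :
  is_orthogonal_mx P -> invmx P = P^T.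
Proof.
move=> PP; have [uT uP] := mulmx1_unit PP.
by rewrite -[LHS]mul1mx -PP -mulmxA mulmxV // mulmx1.
Qed.

Lemma orthogonal_mx_mul m (P Q : 'M[R]_m) :
  is_orthogonal_mx P -> is_orthogonal_mx Q -> is_orthogonal_mx (P *m Q).
Proof.
rewrite /is_orthogonal_mx => PP QQ.
by rewrite trmx_mul mulmxA -(mulmxA Q^T) PP mulmx1.
Qed.

Lemma orthogonal_mx_tr m (P : 'M[R]_m) :
  is_orthogonal_mx P -> is_orthogonal_mx P^T.
Proof. by move=> PP; rewrite /is_orthogonal_mx trmxK orthogonal_mxC. Qed.

Lemma dot_orthogonal m (P : 'M[R]_m) a b :
  is_orthogonal_mx P -> dot (P *m a) (P *m b) = dot a b.
Proof. by move=> PP; rewrite dot_mull mulmxA PP mul1mx. Qed.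

(** Reflecting in the hyperplane orthogonal to x - y swaps two vectors of equal
    length and fixes every z orthogonal to x - y. This is the one tool from
    which the orthonormal bases are built. *)
Lemma householder m (x y : 'cV[R]_m) : dot x x = dot y y ->
  exists P : 'M[R]_m, [/\ is_orthogonal_mx P, P *m x = y
    & forall z, dot z x = dot z y -> P *m z = z].
Proof.
move=> xy; have [->|neq] := eqVneq x y.
  exists 1%:M; rewrite /is_orthogonal_mx trmx1 !mul1mx.
  by split=> // z _; rewrite mul1mx.
pose u := x - y; have u_neq0 : dot u u != 0.
  by apply: contra neq => /eqP/dot_eq0/eqP; rewrite subr_eq0.
pose P : 'M[R]_m := 1%:M - (2 / dot u u) *: (u *m u^T).
have PE z : P *m z = z - (2 * dot u z / dot u u) *: u.
  by rewrite mulmxBl mul1mx -scalemxAl outer_mul scalerA mulrAC.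
have PT : P^T = P.
  by rewrite linearB linearZ /= trmx1 trmx_mul trmxK.
have PP : P *m P = 1%:M.
  rewrite {2}/P mulmxBr mulmx1 -scalemxAr mulmxA PE.
  rewrite /P -addrA -opprD -scalerDr -mulmxDl.
  rewrite [u + _](_ : _ = 0) ?mul0mx ?scaler0 ?subr0 //.
  by rewrite mulfK // -[2]/(1 + 1) scalerDl scale1r opprD addNKr subrr.
exists P; split; first by rewrite /is_orthogonal_mx PT.
- rewrite PE (_ : 2 * _ / _ = 1) ?scale1r ?subKr //.
  have : dot u u = 2 * dot u x.
    rewrite /u dotBl !dotBr dotBl (dotC y x) -xy; ring.
  by move=> <-; rewrite divff.
- move=> z zxy; rewrite PE dotC dotBr zxy subrr mulr0 mul0r scale0r.
  by rewrite subr0.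
Qed.

End EuclideanAlgebra.

(** * Mass tensor and Legendre transform *)

Section MassTensor.
Context {R : realType}.

Lemma vwedge_mul m (a b c : 'cV[R]_m) :
  vwedge a b *m c = dot b c *: a - dot a c *: b.
Proof. by rewrite /vwedge mulmxBl !outer_mul. Qed.

Lemma trmx_vwedge m (a b : 'cV[R]_m) : (vwedge a b)^T = - vwedge a b.
Proof. by rewrite /vwedge linearB /= !trmx_mul !trmxK opprB. Qed.

Lemma vwedge_conj m n (A : 'M[R]_(m, n)) (a b : 'cV[R]_n) :
  A *m vwedge a b *m A^T = vwedge (A *m a) (A *m b).
Proof. by rewrite /vwedge mulmxBr mulmxBl !trmx_mul !mulmxA. Qed.

(** This form, free of coordinates, shows that the tensor depends on the basis
    only through the axis. *)
Lemma axisym_tensorE m (A B : R) :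
  axisym_tensor m A B = B%:M + (A - B) *: (stdvec 0 *m (stdvec 0)^T).
Proof.
apply/matrixP => i j; rewrite !mxE big_ord1 !mxE.
have [<-|ij] := eqVneq i j; last first.
  case: (eqVneq (i : nat) 0%N) => i0; case: (eqVneq (j : nat) 0%N) => j0;
    rewrite ?mulr0 ?mul0r ?mulr0 ?addr0 //.
  by case/eqP: ij; apply: val_inj; rewrite /= i0 j0.
by case: eqP => _ /=; rewrite ?mulr1 ?mulr0 ?addr0 // addrC subrK.
Qed.

Lemma axisym_tensor_mul m (A B : R) (x : 'cV[R]_m) :
  axisym_tensor m A B *m x = B *: x + ((A - B) * dot (stdvec 0) x) *: stdvec 0.
Proof.
rewrite axisym_tensorE mulmxDl mul_scalar_mx -scalemxAl outer_mul.
by rewrite scalerA.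
Qed.

Lemma dot_axisym m (A B : R) (a b : 'cV[R]_m) :
  dot a (axisym_tensor m A B *m b)
  = B * dot a b + (A - B) * (dot (stdvec 0) a * dot (stdvec 0) b).
Proof.
rewrite axisym_tensor_mul dotDr !dotZr [dot a (stdvec 0)]dotC.
by congr (_ + _); rewrite -!mulrA [dot _ b * _]mulrC.
Qed.

Lemma dot_diag m (d : 'rV[R]_m) (a b : 'cV[R]_m) :
  dot a (diag_mx d *m b) = \sum_i d 0 i * (a i 0 * b i 0).
Proof.
rewrite dotE; apply: eq_bigr => i _.
by rewrite mul_diag_mx mxE mulrCA.
Qed.

Lemma dot_diag_ge0 m (d : 'rV[R]_m) (a : 'cV[R]_m) :
  (forall i, 0 < d 0 i) -> 0 <= dot a (diag_mx d *m a).
Proof.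
move=> d_gt0; rewrite dot_diag sumr_ge0 // => i _.
by rewrite mulr_ge0 ?(ltW (d_gt0 i)) // -expr2 sqr_ge0.
Qed.

Lemma dot_diag_gt0 m (d : 'rV[R]_m) (a : 'cV[R]_m) :
  (forall i, 0 < d 0 i) -> dot a a = 1 -> 0 < dot a (diag_mx d *m a).
Proof.
move=> d_gt0 a1; rewrite lt_neqAle dot_diag_ge0 // andbT eq_sym.
rewrite dot_diag psumr_eq0; last first.
  by move=> i _; rewrite mulr_ge0 ?(ltW (d_gt0 i)) // -expr2 sqr_ge0.
apply/negP => /allP a0; have /eqP := a1; rewrite dotE big1 => [|i _].
  by rewrite eq_sym oner_eq0.
have /= := a0 i (mem_index_enum i).
by rewrite mulf_eq0 (gt_eqF (d_gt0 i)) /= => /eqP.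
Qed.

(** For a diagonal mass tensor, C is diagonal with these entries. *)
Definition Cmx_entries m (d : 'rV[R]_m) (q : 'cV[R]_m) : 'rV[R]_m :=
  \row_i (d 0 i + dot q (diag_mx d *m q))^-1.

Lemma Cmx_entries_gt0 m (d : 'rV[R]_m) q :
  (forall i, 0 < d 0 i) -> forall i, 0 < Cmx_entries d q 0 i.
Proof.
by move=> d_gt0 i; rewrite mxE invr_gt0 ltr_pwDl // dot_diag_ge0.
Qed.

Lemma Cmx_diag_inv m (d : 'rV[R]_m) q (d_gt0 : forall i, 0 < d 0 i) :
  diag_mx (Cmx_entries d q) *m (diag_mx d + (dot q (diag_mx d *m q))%:M) = 1%:M.
Proof.
rewrite -diag_const_mx -linearD mulmx_diag -diag_const_mx; congr diag_mx.
apply/rowP => i; rewrite !mxE mulVf //.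
by rewrite gt_eqF // ltr_pwDl // dot_diag_ge0.
Qed.

Lemma Cmx_diag m (d : 'rV[R]_m) q (d_gt0 : forall i, 0 < d 0 i) :
  Cmx (diag_mx d) q = diag_mx (Cmx_entries d q).
Proof.
have CJ := Cmx_diag_inv q d_gt0; have [_ uJ] := mulmx1_unit CJ.
by rewrite /Cmx -[LHS]mul1mx -CJ -mulmxA mulmxV // mulmx1.
Qed.

Lemma Cmx_axisym m (A B : R) (q : 'cV[R]_m) : 0 < A -> 0 < B ->
  let c := dot q (axisym_tensor m A B *m q) in
  Cmx (axisym_tensor m A B) q = axisym_tensor m (A + c)^-1 (B + c)^-1.
Proof.
move=> A0 B0 /=; rewrite {1}/axisym_tensor Cmx_diag => [|i]; last first.
  by rewrite mxE; case: ifP.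
by congr diag_mx; apply/rowP => i; rewrite !mxE; case: ifP.
Qed.

Lemma axisym_gt0 m (A B : R) : 0 < A -> 0 < B ->
  forall i, 0 < (\row_(i < m) if (i : nat) == 0%N then A else B) 0 i.
Proof. by move=> A0 B0 i; rewrite mxE; case: ifP. Qed.

(** C differs from a scalar by a multiple of the projection on the axis, which
    is not seen from directions w orthogonal to it. *)
Lemma dot_Cmx_axisym m (A B : R) (q w x : 'cV[R]_m) :
  0 < A -> 0 < B -> dot w (stdvec 0) = 0 ->
  dot w (Cmx (axisym_tensor m A B) q *m x)
  = (B + dot q (axisym_tensor m A B *m q))^-1 * dot w x.
Proof.
move=> A0 B0 w0; rewrite Cmx_axisym //= dot_axisym [dot (stdvec 0) w]dotC w0.
by rewrite mul0r mulr0 addr0.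
Qed.

(** The Legendre transform and its inverse.  With c = q.Jq and b = v.Jq one has
    p = (J + c) v - b q, so v = C p + b C q, and v.q = 0 determines b. *)
Lemma velocity_of_momentum m (d : 'rV[R]_m) (q v : 'cV[R]_m)
    (d_gt0 : forall i, 0 < d 0 i) :
  let J := diag_mx d in let C := Cmx J q in
  let p := - (inertia_op J (vwedge q v) *m q) in
  dot q q = 1 -> dot q v = 0 ->
  [/\ dot q p = 0, v = C *m (p - (dot p (C *m q) / dot q (C *m q)) *: q)
    & dot v p = 2 * hamiltonian J q p].
Proof.
move=> J C p qq qv; set c := dot q (J *m q); set b := dot v (J *m q).
have pE : p = (J + c%:M) *m v - b *: q.
  rewrite /p /inertia_op mulmxDl -!mulmxA !vwedge_mul qq dotC qv scale0r sub0r.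
  rewrite scale1r mulmxN opprD opprK opprB addrA mulmxDl mul_scalar_mx.
  by rewrite -/c -/b.
have Jsym : J^T = J by rewrite tr_diag_mx.
have qp : dot q p = 0.
  rewrite pE dotBr dotZr qq mulr1 mulmxDl dotDr mul_scalar_mx dotZr qv mulr0.
  by rewrite addr0 -[J]Jsym -dot_mull dotC subrr.
have CE : C = diag_mx (Cmx_entries d q) by exact: Cmx_diag.
have CJ : C *m (J + c%:M) = 1%:M by rewrite CE Cmx_diag_inv.
have qCq : dot q (C *m q) != 0.
  by rewrite gt_eqF // CE dot_diag_gt0 //; exact: Cmx_entries_gt0.
have vE : v = C *m p + b *: (C *m q).
  by rewrite pE mulmxBr mulmxA CJ mul1mx -scalemxAr subrK.
have pCq : dot p (C *m q) = dot q (C *m p).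
  by rewrite CE dotC dot_mull tr_diag_mx.
have bE : b = - (dot p (C *m q) / dot q (C *m q)).
  have : dot q v = dot p (C *m q) + b * dot q (C *m q).
    by rewrite {1}vE dotDr dotZr pCq.
  rewrite qv => /esym/eqP; rewrite addrC addr_eq0 => /eqP h.
  by rewrite -mulNr -h mulfK.
have vE' : v = C *m (p - (dot p (C *m q) / dot q (C *m q)) *: q).
  by rewrite mulmxBr -scalemxAr -scaleNr -bE.
split=> //; rewrite dotC {1}vE' mulmxBr -scalemxAr dotBr dotZr.
rewrite /hamiltonian -/C mulrA divff ?mul1r ?pnatr_eq0 //.
by congr (_ - _); rewrite expr2 mulrAC.
Qed.

End MassTensor.

(** * From the full equations to the reduced ones *)

Section Dynamics.
Context {R : realType}.

Lemma body_frame_orthogonal m (g : 'M[R]_m) r :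
  is_orthogonal_mx g -> body_frame g r = g^T *m stdvec r.
Proof. by move=> gg; rewrite /body_frame orthogonal_mx_inv. Qed.

Lemma dot_body_frame m (g : 'M[R]_m) r s : is_orthogonal_mx g ->
  dot (body_frame g r) (body_frame g s) = dot (stdvec r) (stdvec s : 'cV[R]_m).
Proof.
move=> gg; rewrite !body_frame_orthogonal // dot_orthogonal //.
exact: orthogonal_mx_tr.
Qed.

(** The constraint forces E_r /\ E_s only involve vectors orthogonal to q. *)
Lemma multipliers_kill_axis m (g : 'M[R]_m.+1) (lam : 'I_m.+1 -> 'I_m.+1 -> R) :
  is_orthogonal_mx g ->
  (\sum_(r < m.+1) \sum_(s < m.+1 | (0 < r < s)%N)
     lam r s *: vwedge (body_frame g r) (body_frame g s)) *m body_frame g 0 = 0.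
Proof.
move=> gg; rewrite mulmx_suml big1 // => r _; rewrite mulmx_suml big1 // => s.
move=> /andP[r_gt0 rs]; rewrite -scalemxAl vwedge_mul !dot_body_frame //.
rewrite !(@dot_stdvec_stdvec _ _ _ ord0).
rewrite -!(inj_eq val_inj) /= (gtn_eqF r_gt0) (gtn_eqF (ltn_trans r_gt0 rs)).
by rewrite !scale0r subr0 scaler0.
Qed.

(** Since q' = - Omega q, the derivative of p = - I(Omega) q is - Omega p, the
    constraint forces having no effect on q.  Writing Omega = q /\ v with v
    orthogonal to q turns this into p' = - (v.p) q, and v.p = 2 H. The transpose
    of g stands for its inverse because it is differentiable without any
    information on g near t. *)
Lemma reduction_solution m (d : 'rV[R]_m.+1) (d_gt0 : forall i, 0 < d 0 i)
    (I : set R) (g Om : R -> 'M[R]_m.+1) :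
  let J := diag_mx d in
  let q t := (g t)^T *m stdvec 0 in
  let p t := - (inertia_op J (Om t) *m q t) in
  veselova_solution J I g Om ->
  reduced_solution J I q p /\
  forall t, I t -> let C := Cmx J (q t) in Om t = vwedge (q t)
    (C *m (p t - (dot (p t) (C *m q t) / dot (q t) (C *m q t)) *: q t)).
Proof.
move=> J q p [lam sol].
have main t : I t -> exists v, [/\ dot (q t) (q t) = 1, dot (q t) v = 0,
    Om t = vwedge (q t) v, is_derive t 1 q v
    & is_derive t 1 p (- dot v (p t) *: q t)].
  move=> It; have [[/= gg [v0 OmE]] dg dI] := sol t It.
  have qE : body_frame (g t) 0 = q t by rewrite body_frame_orthogonal.
  have qq : dot (q t) (q t) = 1.
    rewrite -qE dot_body_frame // (@dot_stdvec_stdvec _ _ ord0 ord0).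
    by rewrite eqxx.
  rewrite qE in OmE.
  (* q /\ v only depends on v modulo q. *)
  set v := v0 - dot (q t) v0 *: q t.
  have qv : dot (q t) v = 0 by rewrite dotBr dotZr qq mulr1 subrr.
  have OmE' : Om t = vwedge (q t) v.
    rewrite OmE /vwedge /v linearB linearZ /= mulmxBr mulmxBl.
    by rewrite -scalemxAr -scalemxAl opprB subrKA.
  have OmT : (Om t)^T = - Om t by rewrite OmE' trmx_vwedge.
  have Omq : Om t *m q t = - v.
    by rewrite OmE' vwedge_mul qq dotC qv scale0r scale1r sub0r.
  have dq : is_derive t 1 q v.
    have := is_derive_mulmxr (stdvec 0) (is_derive_trmx dg).
    by rewrite trmx_mul -mulmxA OmT mulNmx Omq opprK.
  have [qp _ _] := velocity_of_momentum d_gt0 qq qv.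
  exists v; split=> //.
  have := is_deriveN (is_derive_mulmx dI dq).
  congr is_derive.
  have Iq : inertia_op J (Om t) *m q t = - p t by rewrite opprK.
  have := multipliers_kill_axis (lam t) gg; rewrite qE mulmxDl => ->.
  rewrite addr0 mulmxBl -!mulmxA Omq Iq (mulmxN _ v) (mulmxN _ (p t)) opprK.
  rewrite addrAC addNr add0r.
  have qp' : dot (q t) (p t) = 0 by rewrite /p OmE'.
  by rewrite OmE' vwedge_mul qp' scale0r subr0 scaleNr.
split=> t It; have [v [qq qv OmE dq dp]] := main t It.
  have pE : p t = - (inertia_op J (vwedge (q t) v) *m q t) by rewrite -OmE.
  have [qp vE Hv] := velocity_of_momentum d_gt0 qq qv.
  rewrite -pE in qp vE Hv.
  split=> /=; first by [].
    by rewrite -vE.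
  by rewrite mulNr -Hv.
have pE : p t = - (inertia_op J (vwedge (q t) v) *m q t) by rewrite -OmE.
have [_ vE _] := velocity_of_momentum d_gt0 qq qv.
by rewrite -pE in vE; rewrite /= -vE.
Qed.

(** * Invariant hyperplanes *)

Lemma continuous_dot m (f g : R -> 'cV[R]_m) (df dg : 'cV[R]_m) (t : R) :
  is_derive t 1 f df -> is_derive t 1 g dg ->
  {for t, continuous (fun s => dot (f s) (g s))}.
Proof.
move=> df1 dg1; have := is_derive_mulmx (is_derive_trmx df1) dg1.
by move=> /is_derive_mxP/(_ 0 0)/is_derive_continuous.
Qed.

(** With be the eigenvalue of C off the axis and sg = (p.Cq) / (q.Cq), the
    functions x = w.q and y = w.p satisfy x' = be (y - sg x), y' = - 2 H x. The
    coefficients are continuous along the solution because q.Cq > 0. *)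
Lemma reduced_invariant_hyperplane m (J1 J2 : R) (J1_gt0 : 0 < J1)
    (J2_gt0 : 0 < J2) (I : set R) (I_itv : is_interval I)
    (q p : R -> 'cV[R]_m)
    (sol : reduced_solution (axisym_tensor m J1 J2) I q p)
    (w : 'cV[R]_m) (w0 : dot w (stdvec 0) = 0) (t0 : R) (It0 : I t0)
    (wq0 : dot w (q t0) = 0) (wp0 : dot w (p t0) = 0) (t : R) (It : I t) :
  dot w (q t) = 0 /\ dot w (p t) = 0.
Proof.
set J := axisym_tensor m J1 J2 in sol.
pose c s := dot (q s) (J *m q s).
pose al s := (J1 + c s)^-1; pose be s := (J2 + c s)^-1.
have CE s : Cmx J (q s) = axisym_tensor m (al s) (be s) by exact: Cmx_axisym.
pose qCq s := dot (q s) (Cmx J (q s) *m q s).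
pose sg s := dot (p s) (Cmx J (q s) *m q s) / qCq s.
pose H s := hamiltonian J (q s) (p s).
have c_ge0 s : 0 <= c s by apply/dot_diag_ge0/axisym_gt0.
have cont s : I s -> [/\ {for s, continuous be}, {for s, continuous sg}
    & {for s, continuous H}].
  move=> Is; have [[/= qq qp] dq dp] := sol s Is.
  have de := is_derive_cst (stdvec 0 : 'cV[R]_m) s 1.
  have c_c : {for s, continuous c}.
    exact: continuous_dot dq (is_derive_mulmxl J dq).
  have cV A : 0 < A -> {for s, continuous (fun u => (A + c u)^-1)}.
    move=> A_gt0; apply: continuousV; first by rewrite gt_eqF // ltr_pwDl.
    by apply: continuousD => //; exact: cst_continuous.
  have be_c : {for s, continuous be} by exact: cV.
  have al_c : {for s, continuous al} by exact: cV.
  (* C is expanded in closed form, so that no inverse matrix remains. *)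
  have dotC_c (f h : R -> 'cV[R]_m) df dh :
      is_derive s 1 f df -> is_derive s 1 h dh ->
      {for s, continuous (fun u => dot (f u) (Cmx J (q u) *m h u))}.
    move=> df1 dh1.
    have -> : (fun u => dot (f u) (Cmx J (q u) *m h u))
        = (fun u => be u * dot (f u) (h u) + (al u - be u)
            * (dot (stdvec 0) (f u) * dot (stdvec 0) (h u))).
      by apply/funext => u; rewrite CE dot_axisym.
    apply: (@continuousD _ _ _ (fun u => be u * dot (f u) (h u))).
      by apply: continuousM => //; exact: continuous_dot df1 dh1.
    apply: (@continuousM _ _ (fun u => al u - be u)).
      exact: (@continuousB _ _ _ al be).
    by apply: continuousM; [exact: continuous_dot de df1
                           |exact: continuous_dot de dh1].
  have qCq_gt0 : 0 < qCq s.
    rewrite /qCq Cmx_diag; last exact: axisym_gt0.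
    by apply: dot_diag_gt0 => //; apply/Cmx_entries_gt0/axisym_gt0.
  have qCq_c : {for s, continuous qCq} by exact: (dotC_c _ _ _ _ dq dq).
  have pCq_c := dotC_c p q _ _ dp dq.
  have qCqV_c : {for s, continuous (fun u => (qCq u)^-1)}.
    by apply: continuousV => //; rewrite gt_eqF.
  split=> //; first exact: (continuousM pCq_c qCqV_c).
  apply: (@continuousM _ _ (fun=> 2^-1)); first exact: cst_continuous.
  apply: (@continuousB _ _ _ (fun u => dot (p u) (Cmx J (q u) *m p u))).
    exact: (dotC_c _ _ _ _ dp dp).
  apply: (@continuousM _ _
    (fun u => dot (p u) (Cmx J (q u) *m q u) ^+ 2)) => //.
  exact: (continuousM pCq_c pCq_c).
apply: (@linear_system_zero R I I_itv (fun s => - (be s * sg s)) be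
  (fun s => - 2 * H s) (fun=> 0) (fun s => dot w (q s)) (fun s => dot w (p s))
  _ _ _ t0 It0 wq0 wp0 t It).
- move=> s Is; have [be_c sg_c H_c] := cont s Is; split=> //.
  + by apply: continuousN; exact: continuousM be_c sg_c.
  + by apply: continuousM => //; exact: cst_continuous.
  + exact: cst_continuous.
- move=> s Is; have [_ dq _] := sol s Is.
  have := is_derive_dot w dq; rewrite /= -/(qCq s) -/(sg s).
  congr is_derive; rewrite dot_Cmx_axisym // -/(c s) -/(be s).
  by rewrite dotBr dotZr; ring.
- move=> s Is; have [_ _ dp] := sol s Is.
  by have := is_derive_dot w dp; rewrite dotZr mul0r addr0.
Qed.

(** * Pulling solutions back along isometric embeddings *)

Section AxialEmbedding.
Variables (m n : nat) (S : 'M[R]_(m, n)).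
Hypothesis SS : S^T *m S = 1%:M.
Hypothesis S0 : S *m stdvec 0 = stdvec 0.

Lemma embedding_axis_tr : S^T *m stdvec 0 = stdvec 0.
Proof. by rewrite -S0 mulmxA SS mul1mx. Qed.

Lemma dot_embedding a b : dot (S *m a) (S *m b) = dot a b.
Proof. by rewrite dot_mull mulmxA SS mul1mx. Qed.

(** Isometric embeddings that send the axis to the axis preserve both the
    scalar part of J and its part along the axis. *)
Lemma axisym_tensor_embedding (A B : R) :
  axisym_tensor m A B *m S = S *m axisym_tensor n A B.
Proof.
rewrite !axisym_tensorE mulmxDl mulmxDr mul_scalar_mx mul_mx_scalar.
rewrite -scalemxAl -scalemxAr mulmxA S0 -mulmxA; congr (_ + _ *: (_ *m _)).
by rewrite -[S in LHS]trmxK -trmx_mul embedding_axis_tr.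
Qed.

Lemma tr_axisym_tensor_embedding (A B : R) :
  S^T *m axisym_tensor m A B = axisym_tensor n A B *m S^T.
Proof.
apply: trmx_inj; rewrite !trmx_mul !trmxK !tr_diag_mx.
exact: axisym_tensor_embedding.
Qed.

Lemma Cmx_embedding (J1 J2 : R) (a x : 'cV[R]_n) : 0 < J1 -> 0 < J2 ->
  Cmx (axisym_tensor m J1 J2) (S *m a) *m (S *m x)
  = S *m (Cmx (axisym_tensor n J1 J2) a *m x).
Proof.
move=> J1_gt0 J2_gt0; rewrite !Cmx_axisym //= (mulmxA _ S x) (mulmxA _ S a).
by rewrite !axisym_tensor_embedding -!mulmxA dot_embedding.
Qed.

Lemma hamiltonian_embedding (J1 J2 : R) (a b : 'cV[R]_n) : 0 < J1 -> 0 < J2 ->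
  hamiltonian (axisym_tensor m J1 J2) (S *m a) (S *m b)
  = hamiltonian (axisym_tensor n J1 J2) a b.
Proof.
by move=> *; rewrite /hamiltonian !Cmx_embedding // !dot_embedding.
Qed.

(** All ingredients of the reduced equations are intertwined by S, so a solution
    with values in the image of S comes from a solution in dimension n. *)
Lemma reduced_solution_embedding (J1 J2 : R) (J1_gt0 : 0 < J1)
    (J2_gt0 : 0 < J2) (I : set R) (q p : R -> 'cV[R]_m)
    (sol : reduced_solution (axisym_tensor m J1 J2) I q p)
    (q_in : forall t, I t -> S *m (S^T *m q t) = q t)
    (p_in : forall t, I t -> S *m (S^T *m p t) = p t) :
  reduced_solution (axisym_tensor n J1 J2) I
    (fun t => S^T *m q t) (fun t => S^T *m p t).
Proof.
move=> t It; have [[/= qq qp] dq dp] := sol t It.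
set J := axisym_tensor m J1 J2 in dq dp.
set a := S^T *m q t; set b := S^T *m p t.
have qE : q t = S *m a by rewrite /a q_in.
have pE : p t = S *m b by rewrite /b p_in.
split; first by split; rewrite /= -/a -/b -dot_embedding -qE -?pE.
- have := is_derive_mulmxl S^T dq; congr is_derive.
  rewrite /= -/a -/b qE pE !Cmx_embedding // !dot_embedding scalemxAr -mulmxBr.
  rewrite Cmx_embedding //.
  by rewrite mulmxA SS mul1mx.
- have := is_derive_mulmxl S^T dp; congr is_derive.
  rewrite -scalemxAr -/a -/b; congr (_ * _ *: _).
  by rewrite qE pE hamiltonian_embedding.
Qed.

End AxialEmbedding.

Lemma sum_delta2 n (Q : 'I_n -> 'I_n -> bool) (F : 'I_n -> 'I_n -> R) i j :
  \sum_r \sum_(s | Q r s) F r s * ((i == r)%:R * (j == s)%:R)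
  = if Q i j then F i j else 0.
Proof.
rewrite (bigD1 i) //= [X in _ + X]big1 => [|r ri]; last first.
  rewrite big1 // => s _.
  by rewrite (eq_sym i) (negPf ri) mul0r mulr0.
rewrite addr0 big_mkcond (bigD1 j) //= big1 => [|s sj].
  by rewrite !eqxx !mulr1 addr0.
by rewrite (eq_sym j) (negPf sj) !mulr0 if_same.
Qed.

(** The first row and column of N vanish, and the remaining entries are those of
    a combination of the wedges of basis vectors. *)
Lemma skew_kills_stdvec0_decomposition n (N : 'M[R]_n.+1) :
  N^T = - N -> N *m stdvec 0 = 0 ->
  N = \sum_(r < n.+1) \sum_(s < n.+1 | (0 < r < s)%N)
    N r s *: vwedge (stdvec r) (stdvec s).
Proof.
move=> NT N0.
have skew i j : N j i = - N i j by have /matrixP/(_ i j) := NT; rewrite !mxE.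
have Ni0 i : N i ord0 = 0.
  by have /colP/(_ i) := N0; rewrite (mulmx_stdvec ord0) !mxE.
have N0i i : N ord0 i = 0 by rewrite skew Ni0 oppr0.
apply/matrixP => i j.
have -> : (\sum_(r < n.+1) \sum_(s < n.+1 | (0 < r < s)%N)
      N r s *: vwedge (stdvec r) (stdvec s)) i j
    = (if (0 < i < j)%N then N i j else 0)
      - (if (0 < j < i)%N then N j i else 0).
  rewrite -(sum_delta2 (fun r s : 'I_n.+1 => (0 < r < s)%N) N).
  rewrite -(sum_delta2 (fun r s : 'I_n.+1 => (0 < r < s)%N) N j i).
  rewrite summxE -sumrB.
  apply: eq_bigr => r _; rewrite summxE -sumrB; apply: eq_bigr => s _.
  rewrite !mxE !big_ord1 !mxE !(inj_eq val_inj) mulrBr.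
  by rewrite [(i == s)%:R * _]mulrC.
case: (ltngtP i j) => ij; rewrite ?andbF ?andbT.
- case: (posnP i) => i0; last by rewrite subr0.
  by rewrite subr0 (_ : i = ord0) //; exact: val_inj.
- case: (posnP j) => j0; last by rewrite sub0r -skew.
  by rewrite subr0 (_ : j = ord0) //; exact: val_inj.
- have -> : i = j by exact: val_inj.
  have := skew j j; lra.
Qed.

(** The previous expansion, read in the frame of the E_r. It yields multipliers
    for any force that satisfies the necessary condition of killing q. *)
Lemma skew_kills_axis_decomposition n (g M : 'M[R]_n.+1) :
  is_orthogonal_mx g -> M^T = - M -> M *m body_frame g 0 = 0 ->
  M = \sum_(r < n.+1) \sum_(s < n.+1 | (0 < r < s)%N)
    (g *m M *m g^T) r s *: vwedge (body_frame g r) (body_frame g s).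
Proof.
move=> gg MT M0; set N := g *m M *m g^T.
have NT : N^T = - N by rewrite /N !trmx_mul trmxK MT mulNmx mulmxN mulmxA.
have N0 : N *m stdvec 0 = 0.
  by rewrite /N -!mulmxA -body_frame_orthogonal // M0 mulmx0.
have -> : M = g^T *m N *m g.
  by rewrite /N !mulmxA gg mul1mx -mulmxA gg mulmx1.
rewrite {1}(skew_kills_stdvec0_decomposition NT N0).
rewrite mulmx_sumr mulmx_suml; apply: eq_bigr => r _.
rewrite mulmx_sumr mulmx_suml; apply: eq_bigr => s _.
rewrite -scalemxAr -scalemxAl; congr (_ *: _).
by rewrite -{2}[g]trmxK vwedge_conj !body_frame_orthogonal.
Qed.

(** S embeds the body and T the space. The projected constraint force M is skew
    and kills q because the original one does and q lies in the image of S; its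
    multipliers are then read off in the frame of the small top. *)
Lemma veselova_solution_embedding (m n : nat) (S T : 'M[R]_(m.+1, n.+1))
    (SS : S^T *m S = 1%:M) (S0 : S *m stdvec 0 = stdvec 0)
    (T0 : T *m stdvec 0 = stdvec 0)
    (J1 J2 : R) (I : set R) (g Om : R -> 'M[R]_m.+1)
    (sol : veselova_solution (axisym_tensor m.+1 J1 J2) I g Om)
    (g_in : forall t, I t -> T *m (T^T *m g t *m S) = g t *m S)
    (Om_in : forall t, I t -> S *m (S^T *m Om t *m S) *m S^T = Om t) :
  veselova_solution (axisym_tensor n.+1 J1 J2) I
    (fun t => T^T *m g t *m S) (fun t => S^T *m Om t *m S).
Proof.
have [lam lamP] := sol.
set J := axisym_tensor m.+1 J1 J2 in lamP; set J' := axisym_tensor n.+1 J1 J2.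
pose gb t := T^T *m g t *m S.
pose Sig t := \sum_(r < m.+1) \sum_(s < m.+1 | (0 < r < s)%N)
  lam t r s *: vwedge (body_frame (g t) r) (body_frame (g t) s).
exists (fun t r s => (gb t *m (S^T *m Sig t *m S) *m (gb t)^T) r s) => t It.
have [[/= gg [v OmE]] dg dI] := lamP t It; rewrite -/(Sig t) in dI.
have gS : g t *m S = T *m gb t by rewrite g_in.
have gbgb : is_orthogonal_mx (gb t).
  rewrite /is_orthogonal_mx {1}/gb !trmx_mul trmxK -!mulmxA -gS.
  by rewrite (mulmxA _ (g t)) gg mul1mx.
have gbgb' := orthogonal_mxC gbgb.
have qbE : body_frame (gb t) 0 = S^T *m body_frame (g t) 0.
  rewrite !body_frame_orthogonal // !trmx_mul trmxK -!mulmxA T0.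
  by [].
have qE : S *m (S^T *m body_frame (g t) 0) = body_frame (g t) 0.
  rewrite -qbE !body_frame_orthogonal //.
  (* It suffices to apply g, which maps both sides to the first space vector. *)
  rewrite -[LHS]mul1mx -gg -!mulmxA; congr (_ *m _).
  by rewrite mulmxA gS -mulmxA (mulmxA _ (gb t)^T) gbgb' mul1mx T0.
have dIb : is_derive t 1 (fun s => inertia_op J' (S^T *m Om s *m S))
    (S^T *m (inertia_op J (Om t) *m Om t - Om t *m inertia_op J (Om t)
      + Sig t) *m S).
  have := is_derive_mulmxr S (is_derive_mulmxl S^T dI).
  congr is_derive; apply/funext => s.
  rewrite /inertia_op mulmxDr mulmxDl !mulmxA.
  rewrite tr_axisym_tensor_embedding //; congr (_ + _).
  by rewrite -!mulmxA axisym_tensor_embedding.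
set Omb := S^T *m Om t *m S.
have OmbE : Om t = S *m Omb *m S^T by rewrite Om_in.
have IE : inertia_op J (Om t) = S *m inertia_op J' Omb *m S^T.
  rewrite /inertia_op OmbE mulmxDr mulmxDl !mulmxA.
  rewrite axisym_tensor_embedding //; congr (_ + _).
  by rewrite -!mulmxA tr_axisym_tensor_embedding.
have conjM X Y : S^T *m (S *m X *m S^T *m (S *m Y *m S^T)) *m S = X *m Y.
  rewrite !mulmxA SS mul1mx -!mulmxA SS mulmx1.
  by rewrite (mulmxA S^T) SS mul1mx.
set M := S^T *m Sig t *m S.
have M0 : M *m body_frame (gb t) 0 = 0.
  by rewrite qbE -!mulmxA qE multipliers_kill_axis // mulmx0.
have MT : M^T = - M.
  rewrite /M !trmx_mul trmxK mulmxA -mulNmx -mulmxN; congr (_ *m _ *m _).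
  rewrite /Sig raddf_sum -sumrN /=; apply: eq_bigr => r _.
  rewrite raddf_sum -sumrN /=; apply: eq_bigr => s _.
  by rewrite linearZ /= trmx_vwedge scalerN.
have ME : M = \sum_(r < n.+1) \sum_(s < n.+1 | (0 < r < s)%N)
    (gb t *m M *m (gb t)^T) r s
      *: vwedge (body_frame (gb t) r) (body_frame (gb t) s).
  exact: skew_kills_axis_decomposition.
split.
- split=> //=; exists (S^T *m v).
  by rewrite -/(gb t) qbE -vwedge_conj trmxK /Omb OmE.
- have := is_derive_mulmxr S (is_derive_mulmxl T^T dg).
  congr is_derive; rewrite {1}OmbE -!mulmxA SS mulmx1.
  by rewrite -/Omb !mulmxA.
- move: dIb; congr is_derive; rewrite mulmxDr mulmxDl -/M {1}ME.
  congr (_ + _); rewrite mulmxBr mulmxBl IE.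
  by rewrite OmbE !conjM.
Qed.

End Dynamics.

(** * Orthonormal bases adapted to the motion *)

Section AdaptedBases.
Context {R : realType}.

(** One step of the QR algorithm: the entries of x from index j on are gathered
    in entry j alone. Vectors supported before j are not moved, so that the
    zeros created by earlier steps survive. *)
Lemma reflection_clearing_tail n (j : 'I_n) (x : 'cV[R]_n) :
  exists P : 'M[R]_n, [/\ is_orthogonal_mx P,
    forall z : 'cV[R]_n,
      (forall i : 'I_n, (j <= i)%N -> z i 0 = 0) -> P *m z = z
    & forall i : 'I_n, (j < i)%N -> (P *m x) i 0 = 0].
Proof.
pose r := Num.sqrt (\sum_(i < n | ~~ (i < j)%N) x i 0 ^+ 2).
pose y : 'cV[R]_n :=
  \col_i if (i < j)%N then x i 0 else if i == j then r else 0.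
have xy : dot x x = dot y y.
  rewrite !dotE (bigID (fun i : 'I_n => (i < j)%N)).
  rewrite [RHS](bigID (fun i : 'I_n => (i < j)%N)) /=; congr (_ + _).
    by apply: eq_bigr => i ij; rewrite mxE ij.
  rewrite [RHS](bigD1 j) ?ltnn //= [X in _ = _ + X]big1 => [|i /andP[ij neq]].
    rewrite addr0 mxE ltnn eqxx -expr2 sqr_sqrtr; last first.
      by rewrite sumr_ge0 // => i _; rewrite sqr_ge0.
    by apply: eq_bigr => i _; rewrite expr2.
  by rewrite mxE (negPf ij) (negPf neq) mul0r.
have [P [PP Px Pfix]] := householder xy.
exists P; split=> // [z z0|i ji].
  apply: Pfix; rewrite !dotE; apply: eq_bigr => i _; rewrite mxE.
  by have [//|ji] := ltnP i j; rewrite z0 // !mul0r.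
by rewrite Px mxE ltnNge (ltnW ji) /= -val_eqE /= gtn_eqF.
Qed.

(** Clear q0 after index 1, then p0 after index 2. Both steps start at a
    positive index and so keep the axis. *)
Lemma adapted_body_basis k (q0 p0 : 'cV[R]_(3 + k)) :
  exists P : 'M[R]_(3 + k), [/\ is_orthogonal_mx P, P *m stdvec 0 = stdvec 0,
    dsubmx (P *m q0) = 0 & dsubmx (P *m p0) = 0].
Proof.
have lt1 : (1 < 3 + k)%N by [].
have lt2 : (2 < 3 + k)%N by [].
have [P1 [PP1 fix1 tail1]] := reflection_clearing_tail (Ordinal lt1) q0.
have [P2 [PP2 fix2 tail2]] :=
  reflection_clearing_tail (Ordinal lt2) (P1 *m p0).
have e0 j : (0 < j)%N -> forall i : 'I_(3 + k), (j <= i)%N ->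
    (stdvec 0 : 'cV[R]_(3 + k)) i 0 = 0.
  by move=> j0 i ji; rewrite mxE gtn_eqF // (leq_trans j0).
exists (P2 *m P1); split; first exact: orthogonal_mx_mul.
- by rewrite -mulmxA fix1 ?fix2 //; exact: e0.
- rewrite -mulmxA fix2 => [|i i2]; last exact: tail1.
  by apply/colP => i; rewrite [LHS]mxE tail1 // mxE.
- by rewrite -mulmxA; apply/colP => i; rewrite [LHS]mxE tail2 // mxE.
Qed.

(** The transpose of G also fixes the last basis vectors. *)
Lemma orthogonal_mx_fixing_tail m k (G : 'M[R]_(m + k)) :
  is_orthogonal_mx G -> G *m col_mx 0 1%:M = col_mx 0 1%:M ->
  G = block_mx (ulsubmx G) 0 0 1%:M.
Proof.
move=> GG Gfix.
have GTfix : G^T *m col_mx 0 1%:M = col_mx 0 1%:M.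
  by rewrite -{1}Gfix mulmxA GG mul1mx.
move: Gfix; rewrite -{1}[G]submxK mul_block_col !mulmx0 !add0r !mulmx1.
move=> /eq_col_mx[ur dr].
move: GTfix; rewrite -{1}[G]submxK tr_block_mx mul_block_col.
rewrite !mulmx0 !add0r !mulmx1 => /eq_col_mx[dl _].
by rewrite -{1}[G]submxK ur dr -[dlsubmx G]trmxK dl trmx0.
Qed.

Definition head_mx m k : 'M[R]_(m + k, m) := col_mx 1%:M 0.

Lemma head_mxK m k : (head_mx m k)^T *m head_mx m k = 1%:M.
Proof. by rewrite tr_col_mx mul_row_col trmx1 mulmx1 mulmx0 addr0. Qed.

Lemma mul_head_mx m k n (A : 'M[R]_(m, n)) : head_mx m k *m A = col_mx A 0.
Proof. by rewrite mul_col_mx mul1mx mul0mx. Qed.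

Lemma mul_tr_head_mx m k n (A : 'M[R]_(m + k, n)) :
  (head_mx m k)^T *m A = usubmx A.
Proof.
rewrite -{1}[A]vsubmxK tr_col_mx mul_row_col trmx1 trmx0 mul1mx mul0mx.
by rewrite addr0.
Qed.

Lemma head_mx_stdvec m k : head_mx m.+1 k *m stdvec 0 = stdvec 0.
Proof.
rewrite mul_head_mx; apply/colP => i; rewrite mxE.
by case: splitP => j ij; rewrite !mxE ij.
Qed.

End AdaptedBases.

Unset Implicit Arguments.

(* The dimension is n = 3 + k with k > 0. The rows of Pb (resp. Ps) are the new
   orthonormal basis vectors of the body (resp. space). *)
Theorem theorem4p3 (R : realType) (k : nat) (k_gt0 : (0 < k)%N)
    (J1 J2 : R) (J1_gt0 : 0 < J1) (J2_gt0 : 0 < J2) (J1_neq_J2 : J1 != J2)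
    (I : set R) (I_open : open I) (I_itv : is_interval I)
    (t0 : R) (t0_in_I : I t0)
    (gam : R -> set ('cV[R]_(3 + k) * 'cV[R]_(3 + k)))
    (gam_sol : quotient_solution (axisym_tensor (3 + k) J1 J2) I gam)
    (g0 Om0 : 'M[R]_(3 + k)) (q0 p0 : 'cV[R]_(3 + k))
    (lift_D : phase_D (g0, Om0))
    (lift_red : reduction (axisym_tensor (3 + k) J1 J2) (g0, Om0) = (q0, p0))
    (lift_gam : axial_orbit (q0, p0) = gam t0)
    (q p : R -> 'cV[R]_(3 + k))
    (qp_sol : reduced_solution (axisym_tensor (3 + k) J1 J2) I q p)
    (qp_init : (q t0, p t0) = (q0, p0))
    (g Om : R -> 'M[R]_(3 + k))
    (gOm_sol : veselova_solution (axisym_tensor (3 + k) J1 J2) I g Om)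
    (gOm_init : (g t0, Om t0) = (g0, Om0)) :
  exists Pb Ps : 'M[R]_(3 + k),
    [/\ is_orthogonal_mx Pb, Pb *m stdvec 0 = stdvec 0,
        is_orthogonal_mx Ps, Ps *m stdvec 0 = stdvec 0
      & exists (qb pb : R -> 'cV[R]_3) (gb Omb : R -> 'M[R]_3),
          [/\ forall t, I t ->
                [/\ Pb *m q t = col_mx (qb t) 0,
                    Pb *m p t = col_mx (pb t) 0,
                    Ps *m g t *m Pb^T = block_mx (gb t) 0 0 1%:M
                  & Pb *m Om t *m Pb^T = block_mx (Omb t) 0 0 0],
              reduced_solution (axisym_tensor 3 J1 J2) I qb pb
            & veselova_solution (axisym_tensor 3 J1 J2) I gb Omb]].
Proof.
have axisym_pos m := axisym_gt0 (m := m) J1_gt0 J2_gt0.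
set J := axisym_tensor (3 + k) J1 J2 in qp_sol gOm_sol lift_red *.
have [q_t0 p_t0] : q t0 = q0 /\ p t0 = p0 by case: qp_init.
have [g_t0 Om_t0] : g t0 = g0 /\ Om t0 = Om0 by case: gOm_init.
have [g0_orth _] := lift_D; rewrite /= in g0_orth.
have [Pb [Pb_orth Pb0 Pbq0 Pbp0]] := adapted_body_basis q0 p0.
have PbPbT := orthogonal_mxC Pb_orth.
have PbT0 : Pb^T *m stdvec 0 = stdvec 0.
  by rewrite -{1}Pb0 mulmxA Pb_orth mul1mx.
pose tailv (i : 'I_k) : 'cV[R]_(3 + k) := stdvec (rshift 3 i).
have dsubE (x : 'cV[R]_(3 + k)) i : dsubmx x i 0 = dot (tailv i) x.
  by rewrite dot_stdvec mxE.
have tailv0 i : dot (tailv i) (stdvec 0) = 0 by rewrite dot_stdvec mxE.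
have Pb_row i (x : 'cV[R]_(3 + k)) :
    dot (Pb^T *m tailv i) x = dsubmx (Pb *m x) i 0.
  by rewrite dot_mull trmxK dsubE.
pose S := Pb^T *m head_mx 3 k.
have SS : S^T *m S = 1%:M.
  by rewrite /S trmx_mul trmxK mulmxA -(mulmxA _ Pb) PbPbT mulmx1 head_mxK.
have S0 : S *m stdvec 0 = stdvec 0 by rewrite -mulmxA head_mx_stdvec.
have Sin (x : 'cV[R]_(3 + k)) : dsubmx (Pb *m x) = 0 -> S *m (S^T *m x) = x.
  move=> x0; rewrite /S trmx_mul trmxK -!mulmxA mul_tr_head_mx mul_head_mx.
  by rewrite -{1}x0 vsubmxK mulmxA Pb_orth mul1mx.
(* The rows of Pb past the third are orthogonal to the axis and to the initial
   condition, hence to the whole solution. *)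
have stays (a b : R -> 'cV[R]_(3 + k)) : reduced_solution J I a b ->
    a t0 = q0 -> b t0 = p0 ->
    forall t, I t -> dsubmx (Pb *m a t) = 0 /\ dsubmx (Pb *m b t) = 0.
  move=> ab_sol a0 b0 t It.
  have inv i : dot (Pb^T *m tailv i) (a t) = 0
      /\ dot (Pb^T *m tailv i) (b t) = 0.
    apply: (reduced_invariant_hyperplane J1_gt0 J2_gt0 I_itv ab_sol _ t0_in_I).
    - by rewrite Pb_row Pb0 dsubE tailv0.
    - by rewrite Pb_row a0 Pbq0 mxE.
    - by rewrite Pb_row b0 Pbp0 mxE.
    - exact: It.
  by split; apply/colP => i; rewrite -Pb_row mxE; case: (inv i).
pose qg s := (g s)^T *m stdvec 0; pose pg s := - (inertia_op J (Om s) *m qg s).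
have [red_sol OmE] : reduced_solution J I qg pg /\ forall t, I t ->
    exists sg, Om t = vwedge (qg t) (Cmx J (qg t) *m (pg t - sg *: qg t)).
  have [red_sol OmE] := reduction_solution (axisym_pos (3 + k)%N) gOm_sol.
  by split=> // t It; eexists; exact: OmE.
have qg0 : qg t0 = q0.
  by case: lift_red => + _; rewrite /= body_frame_orthogonal // /qg g_t0.
have pg0 : pg t0 = p0.
  case: lift_red => _; rewrite /= body_frame_orthogonal // => <-.
  by rewrite /pg /qg g_t0 Om_t0.
have qg_in t : I t -> S *m (S^T *m qg t) = qg t.
  by move=> It; apply: Sin; case: (stays _ _ red_sol qg0 pg0 t It).
have Om_in t : I t -> S *m (S^T *m Om t *m S) *m S^T = Om t.
  move=> It; have [sg Omt] := OmE t It; set v := _ *m _ in Omt.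
  have v_in : S *m (S^T *m v) = v.
    apply: Sin; apply/colP => i.
    have [qgD pgD] := stays _ _ red_sol qg0 pg0 t It.
    rewrite -Pb_row [RHS]mxE dot_Cmx_axisym //; last first.
      by rewrite Pb_row Pb0 dsubE tailv0.
    by rewrite dotBr dotZr !Pb_row qgD pgD !mxE mulr0 subrr mulr0.
  have := vwedge_conj S^T (qg t) v; rewrite trmxK -Omt => ->.
  by rewrite vwedge_conj v_in qg_in.
(* T corrects the space basis that makes g the identity at t0: there e_1 reads
   as Pb q0, a vector of R^3, and T makes it the first basis vector without
   moving the last n - 3 ones. *)
have [T [T_orth Tq T_fix]] : exists T : 'M[R]_(3 + k), [/\ is_orthogonal_mx T,
    T *m (Pb *m q0) = stdvec 0 & forall i, T *m tailv i = tailv i].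
  have norms : dot (Pb *m q0) (Pb *m q0)
      = dot (stdvec 0) (stdvec 0 : 'cV[R]_(3 + k)).
    rewrite dot_orthogonal // -qg0 /qg g_t0 dot_orthogonal //.
    exact: orthogonal_mx_tr.
  have [T [T_orth Tq T_fix]] := householder norms.
  exists T; split=> // i; apply: T_fix.
  by rewrite -dsubE Pbq0 mxE tailv0.
pose G0 := g0 *m Pb^T.
have G0_orth : is_orthogonal_mx G0.
  by apply: orthogonal_mx_mul => //; exact: orthogonal_mx_tr.
pose Ps := T *m G0^T.
have Ps_orth : is_orthogonal_mx Ps.
  by apply: orthogonal_mx_mul => //; exact: orthogonal_mx_tr.
have Ps0 : Ps *m stdvec 0 = stdvec 0.
  rewrite -[RHS]Tq /Ps /G0 trmx_mul trmxK -!mulmxA -qg0 /qg g_t0.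
  by [].
(* G is the attitude matrix in the new bases; its last columns are constant
   since Omega kills the last body vectors. *)
pose G t := Ps *m g t *m Pb^T.
pose tail_mx : 'M[R]_(3 + k, k) := col_mx 0 1%:M.
have G_tail0 : G t0 *m tail_mx = tail_mx.
  rewrite /G g_t0 -(mulmxA Ps) -/G0 /Ps -(mulmxA T) G0_orth mulmx1.
  have entryE l j : tail_mx l j = tailv j l 0.
    rewrite !mxE; case: splitP => i li; rewrite mxE li.
      by rewrite ltn_eqF // ltn_addr.
    by rewrite eqn_add2l.
  apply/matrixP => l j; rewrite entryE -[in RHS]T_fix !mxE.
  by apply: eq_bigr => i _; rewrite entryE.
have S_tail : S^T *m (Pb^T *m tail_mx) = 0.
  rewrite /S trmx_mul trmxK -!mulmxA (mulmxA Pb) PbPbT mul1mx mul_tr_head_mx.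
  by rewrite col_mxKu.
have G_tail t : I t -> G t *m tail_mx = tail_mx.
  move=> It; rewrite -[RHS]G_tail0.
  apply: (derive_eq0_constant I_itv (f := fun s => G s *m tail_mx)) => // s Is.
  have [lam /(_ s Is)[_ dg _]] := gOm_sol.
  have := is_derive_mulmxr (Pb^T *m tail_mx) (is_derive_mulmxl Ps dg).
  rewrite -(Om_in s Is) -!mulmxA S_tail !mulmx0.
  by congr is_derive; apply/funext => u; rewrite /G !mulmxA.
have G_orth t : I t -> is_orthogonal_mx (G t).
  move=> It; have [lam /(_ t It)[[/= gg _] _ _]] := gOm_sol.
  apply: orthogonal_mx_mul; first exact: orthogonal_mx_mul.
  exact: orthogonal_mx_tr.
have G_block t : I t -> G t = block_mx (ulsubmx (G t)) 0 0 1%:M.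
  by move=> It; apply: orthogonal_mx_fixing_tail; [exact: G_orth|exact: G_tail].
pose U := Ps^T *m head_mx 3 k.
have U0 : U *m stdvec 0 = stdvec 0.
  rewrite /U -(mulmxA Ps^T) head_mx_stdvec -{1}Ps0 (mulmxA Ps^T) Ps_orth.
  by rewrite mul1mx.
have gbE t : U^T *m g t *m S = ulsubmx (G t).
  rewrite /U /S trmx_mul trmxK -!mulmxA mul_tr_head_mx !mulmxA -/(G t).
  rewrite -{1}[G t]submxK /head_mx mul_block_col !mulmx1 !mulmx0 !addr0.
  by rewrite col_mxKu.
have g_in t : I t -> U *m (U^T *m g t *m S) = g t *m S.
  move=> It; rewrite gbE -mulmxA mul_head_mx.
  have <- : G t *m head_mx 3 k = col_mx (ulsubmx (G t)) 0.
    by rewrite {1}(G_block t It) mul_block_col !mulmx1 !mulmx0 !addr0.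
  by rewrite /G -!(mulmxA Ps) (mulmxA Ps^T) Ps_orth mul1mx -mulmxA.
exists Pb, Ps; split=> //.
exists (fun t => S^T *m q t), (fun t => S^T *m p t),
  (fun t => U^T *m g t *m S), (fun t => S^T *m Om t *m S).
have STE (x : 'cV[R]_(3 + k)) : S^T *m x = usubmx (Pb *m x).
  by rewrite /S trmx_mul trmxK -mulmxA mul_tr_head_mx.
split.
- move=> t It; have [qD pD] := stays _ _ qp_sol q_t0 p_t0 t It; split.
  + by rewrite STE -qD vsubmxK.
  + by rewrite STE -pD vsubmxK.
  + by rewrite gbE; exact: G_block.
  + have PbS : Pb *m S = head_mx 3 k by rewrite mulmxA PbPbT mul1mx.
    rewrite -{1}(Om_in t It); set X := S^T *m Om t *m S.
    rewrite -(mulmxA S X) (mulmxA Pb S) PbS -(mulmxA (head_mx 3 k)).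
    rewrite -(mulmxA X) -trmx_mul PbS mul_head_mx /head_mx tr_col_mx.
    by rewrite trmx1 trmx0 mul_mx_row mulmx1 mulmx0 /block_mx row_mx0.
- apply: (reduced_solution_embedding SS S0 J1_gt0 J2_gt0 qp_sol) => t It;
    by apply: Sin; case: (stays _ _ qp_sol q_t0 p_t0 t It).
- exact: (@veselova_solution_embedding R (2 + k) 2 S U SS S0 U0 J1 J2 I g Om).
Qed.
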